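(* Let $(A,\nwarrow,\nearrow,\alpha)$ be a real $3$-Hom-L-dendriform algebra and let $J$ be an almost complex structure on $A$ (a linear map $J:A\to A$ with $J^2=-\mathrm{id}_A$) commuting with $\alpha$. If for all $x,y,z\in A$ $$J\nwarrow(x,y,z)=-\nwarrow(Jx,Jy,Jz),\qquad J\nearrow(x,y,z)=-\nearrow(Jx,Jy,Jz),$$ then $J$ is a complex structure on $A$ (called a perfect complex structure).
   Context: Vector spaces are finite-dimensional over $\mathbb R$ or $\mathbb C$; ''real'' means over $\mathbb R$. A $3$-Hom-L-dendriform algebra is a tuple $(A,\nwarrow,\nearrow,\alpha)$ where $A$ is a vector space, $\nwarrow,\nearrow:\otimes^3A\to A$ and $\alpha:A\to A$ are linear, $\alpha$ is multiplicative (i.e. $\alpha(\nwarrow(x,y,z))=\nwarrow(\alpha(x),\alpha(y),\alpha(z))$ and likewise for $\nearrow$), and, writing $\{x,y,z\}^h=\nwarrow(x,y,z)+\nearrow(x,y,z)-\nearrow(y,x,z)$, $\{x,y,z\}^v=\nwarrow(x,y,z)+\nearrow(z,x,y)-\nearrow(z,y,x)$, $[x,y,z]^C=\{x,y,z\}^h+\{y,z,x\}^h+\{z,x,y\}^h$ (equal to the same cyclic sum of $\{\cdot,\cdot,\cdot\}^v$), the following hold for all $x_1,\dots,x_5\in A$ (where $\circlearrowleft_{1,2,3}$ is the sum over cyclic permutations of the indices $1,2,3$): (0) $\nwarrow(x_1,x_2,x_3)+\nwarrow(x_2,x_1,x_3)=0$; (1) $\nwarrow(\alpha(x_1),\alpha(x_2),\nwarrow(x_3,x_4,x_5))-\nwarrow(\alpha(x_3),\alpha(x_4),\nwarrow(x_1,x_2,x_5))=\nwarrow([x_1,x_2,x_3]^C,\alpha(x_4),\alpha(x_5))-\nwarrow([x_1,x_2,x_4]^C,\alpha(x_3),\alpha(x_5))$;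 (2) $\nwarrow(\alpha(x_1),\alpha(x_2),\nearrow(x_5,x_3,x_4))-\nearrow(\alpha(x_5),\alpha(x_3),\{x_1,x_2,x_4\}^h)=\nearrow(\alpha(x_5),[x_1,x_2,x_3]^C,\alpha(x_4))+\nearrow(\{x_1,x_2,x_5\}^v,\alpha(x_3),\alpha(x_4))$; (3) $\nearrow(\alpha(x_5),\alpha(x_1),\{x_2,x_3,x_4\}^h)-\nwarrow(\alpha(x_2),\alpha(x_3),\nearrow(x_5,x_1,x_4))=\nearrow(\{x_1,x_2,x_5\}^v,\alpha(x_3),\alpha(x_4))-\nearrow(\{x_1,x_3,x_5\}^v,\alpha(x_2),\alpha(x_4))$; (4) $\nwarrow([x_1,x_2,x_3]^C,\alpha(x_4),\alpha(x_5))=\circlearrowleft_{1,2,3}\nwarrow(\alpha(x_1),\alpha(x_2),\nwarrow(x_3,x_4,x_5))$; (5) $\nearrow(\alpha(x_5),[x_1,x_2,x_3]^C,\alpha(x_4))=\circlearrowleft_{1,2,3}\nwarrow(\alpha(x_1),\alpha(x_2),\nearrow(x_5,x_3,x_4))$; (6) $\nwarrow(\alpha(x_1),\alpha(x_2),\nearrow(x_5,x_3,x_4))+\nearrow(\alpha(x_5),\alpha(x_1),\{x_2,x_3,x_4\}^h)=\nearrow(\alpha(x_5),\alpha(x_2),\{x_1,x_3,x_4\}^h)+\nearrow(\{x_1,x_2,x_5\}^v,\alpha(x_3),\alpha(x_4))$. A complex structure on $A$ is a linear map $J:A\to A$ with $J^2=-\mathrm{id}_A$ which is a Nijenhuis operator;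 equivalently $J^2=-\mathrm{id}_A$, $J\alpha=\alpha J$ and, for $\ast\in\{\nwarrow,\nearrow\}$ and all $x,y,z\in A$, $$J\ast(x,y,z)=-\ast(Jx,Jy,Jz)+\ast(Jx,y,z)+\ast(x,Jy,z)+\ast(x,y,Jz)+J\ast(Jx,Jy,z)+J\ast(x,Jy,Jz)+J\ast(Jx,y,Jz).$$ *)

(* Defs.v *)
From mathcomp Require Import all_boot all_order all_algebra.

Set Implicit Arguments.
Unset Strict Implicit.
Unset Printing Implicit Defensive.

Import GRing.Theory.
Local Open Scope ring_scope.

(* A linear map on the triple tensor power of A is encoded, via the universal
   property, as a curried ternary operation linear in each argument.          *)
Definition trilinear (K : fieldType) (A : vectType K) (f : A -> A -> A -> A) : Prop :=
  [/\ forall y z, linear (fun x => f x y z),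
      forall x z, linear (fun y => f x y z)
    & forall x y, linear (fun z => f x y z)].

Definition multiplicative3 (K : fieldType) (A : vectType K)
    (f : A -> A -> A -> A) (alpha : 'End(A)) : Prop :=
  forall x y z, alpha (f x y z) = f (alpha x) (alpha y) (alpha z).

Section Brackets.
Variables (K : fieldType) (A : vectType K) (nw ne : A -> A -> A -> A).

Definition hbr (x y z : A) : A := nw x y z + ne x y z - ne y x z.

Definition vbr (x y z : A) : A := nw x y z + ne z x y - ne z y x.

Definition cbr (x y z : A) : A := hbr x y z + hbr y z x + hbr z x y.

Lemma cbr_vbr (x y z : A) : cbr x y z = vbr x y z + vbr y z x + vbr z x y.
Proof.
rewrite /cbr /hbr /vbr.
by rewrite (AC (3*3*3) (1*8*6*(4*2*9)*(7*5*3))).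
Qed.

End Brackets.

(* nw and ne stand for the operations written with a north-west and a
   north-east arrow.                                                          *)
Record hom_L_dendriform3 (K : fieldType) (A : vectType K)
    (nw ne : A -> A -> A -> A) (alpha : 'End(A)) : Prop := HomLDendriform3 {
  nw_trilinear : trilinear nw;
  ne_trilinear : trilinear ne;
  nw_multiplicative : multiplicative3 nw alpha;
  ne_multiplicative : multiplicative3 ne alpha;
  hld_0 : forall x1 x2 x3, nw x1 x2 x3 + nw x2 x1 x3 = 0;
  hld_1 : forall x1 x2 x3 x4 x5,
    nw (alpha x1) (alpha x2) (nw x3 x4 x5)
      - nw (alpha x3) (alpha x4) (nw x1 x2 x5)
    = nw (cbr nw ne x1 x2 x3) (alpha x4) (alpha x5)
      - nw (cbr nw ne x1 x2 x4) (alpha x3) (alpha x5);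
  hld_2 : forall x1 x2 x3 x4 x5,
    nw (alpha x1) (alpha x2) (ne x5 x3 x4)
      - ne (alpha x5) (alpha x3) (hbr nw ne x1 x2 x4)
    = ne (alpha x5) (cbr nw ne x1 x2 x3) (alpha x4)
      + ne (vbr nw ne x1 x2 x5) (alpha x3) (alpha x4);
  hld_3 : forall x1 x2 x3 x4 x5,
    ne (alpha x5) (alpha x1) (hbr nw ne x2 x3 x4)
      - nw (alpha x2) (alpha x3) (ne x5 x1 x4)
    = ne (vbr nw ne x1 x2 x5) (alpha x3) (alpha x4)
      - ne (vbr nw ne x1 x3 x5) (alpha x2) (alpha x4);
  hld_4 : forall x1 x2 x3 x4 x5,
    nw (cbr nw ne x1 x2 x3) (alpha x4) (alpha x5)
    = nw (alpha x1) (alpha x2) (nw x3 x4 x5)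
      + nw (alpha x2) (alpha x3) (nw x1 x4 x5)
      + nw (alpha x3) (alpha x1) (nw x2 x4 x5);
  hld_5 : forall x1 x2 x3 x4 x5,
    ne (alpha x5) (cbr nw ne x1 x2 x3) (alpha x4)
    = nw (alpha x1) (alpha x2) (ne x5 x3 x4)
      + nw (alpha x2) (alpha x3) (ne x5 x1 x4)
      + nw (alpha x3) (alpha x1) (ne x5 x2 x4);
  hld_6 : forall x1 x2 x3 x4 x5,
    nw (alpha x1) (alpha x2) (ne x5 x3 x4)
      + ne (alpha x5) (alpha x1) (hbr nw ne x2 x3 x4)
    = ne (alpha x5) (alpha x2) (hbr nw ne x1 x3 x4)
      + ne (vbr nw ne x1 x2 x5) (alpha x3) (alpha x4)
}.

Section Nijenhuis.
Variables (K : fieldType) (A : vectType K).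
Implicit Types (f : A -> A -> A -> A) (N : 'End(A)).

(* N is a Nijenhuis operator for f when f (N x) (N y) (N z) = N (f_2 x y z),
   where f_1, f_2 (deform1, deform2) are the successive deformations of f by N;
   see complex_structureP for the explicit integrability identity obtained
   when N ^ 2 = - id.                                                         *)
Definition deform1 f N (x y z : A) : A :=
  f (N x) y z + f x (N y) z + f x y (N z) - N (f x y z).

Definition deform2 f N (x y z : A) : A :=
  f (N x) (N y) z + f x (N y) (N z) + f (N x) y (N z) - N (deform1 f N x y z).

Definition nijenhuis_for f N : Prop :=
  forall x y z, f (N x) (N y) (N z) = N (deform2 f N x y z).

Definition nijenhuis nw ne (alpha : 'End(A)) N : Prop :=
  [/\ forall x, N (alpha x) = alpha (N x), nijenhuis_for nw N
    & nijenhuis_for ne N].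

Definition almost_complex_structure (J : 'End(A)) : Prop :=
  forall x, J (J x) = - x.

Definition complex_structure nw ne (alpha J : 'End(A)) : Prop :=
  almost_complex_structure J /\ nijenhuis nw ne alpha J.

Definition integrable_for f (J : 'End(A)) : Prop := forall x y z,
  J (f x y z) = - f (J x) (J y) (J z)
    + f (J x) y z + f x (J y) z + f x y (J z)
    + J (f (J x) (J y) z) + J (f x (J y) (J z)) + J (f (J x) y (J z)).

Lemma nijenhuis_forP f (J : 'End(A)) : almost_complex_structure J ->
  nijenhuis_for f J <-> integrable_for f J.
Proof.
move=> JJ.
have E x y z : J (deform2 f J x y z) =
    (J (f (J x) (J y) z) + J (f x (J y) (J z)) + J (f (J x) y (J z)))
    + (f (J x) y z + f x (J y) z + f x y (J z)) - J (f x y z).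
  by rewrite /deform2 linearB /= JJ opprK /deform1 !linearD addrA.
pose X x y z := f (J x) y z + f x (J y) z + f x y (J z)
  + (J (f (J x) (J y) z) + J (f x (J y) (J z)) + J (f (J x) y (J z))).
have IE x y z : - f (J x) (J y) (J z)
    + f (J x) y z + f x (J y) z + f x y (J z)
    + J (f (J x) (J y) z) + J (f x (J y) (J z)) + J (f (J x) y (J z))
    = X x y z - f (J x) (J y) (J z).
  by rewrite /X [RHS]addrC !addrA.
have NE x y z : J (deform2 f J x y z) = X x y z - J (f x y z).
  by rewrite E; congr (_ - _); rewrite addrC.
split=> H x y z; have := H x y z; rewrite ?IE ?NE => ->;
  by rewrite opprB addrC subrK.
Qed.

Lemma complex_structureP nw ne (alpha J : 'End(A)) :
  complex_structure nw ne alpha J <->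
  [/\ forall x, J (J x) = - x, forall x, J (alpha x) = alpha (J x),
      integrable_for nw J & integrable_for ne J].
Proof.
split=> [[JJ [Ja Hw He]]|[JJ Ja Hw He]].
  by split=> //; apply/nijenhuis_forP.
by split=> //; split=> //; apply/nijenhuis_forP.
Qed.

End Nijenhuis.

(* Main.v *)
Require Import Defs.
From mathcomp Require Import all_boot all_order all_algebra.
From mathcomp Require Import reals.

Set Implicit Arguments.
Unset Strict Implicit.
Unset Printing Implicit Defensive.

Import GRing.Theory.
Local Open Scope ring_scope.

(** Since [J] squares to minus the identity, pushing [J] through [f] at arguments two of which
    already carry [J] turns these two into negatives, whose signs cancel by trilinearity. So each
    term [J (f ..)] of the integrability identity cancels one term with a single [J], and what is
    left is the perfectness hypothesis. [perfect_integrable_for] does this for any trilinear [f];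
    [complex_structureP] returns to the Nijenhuis form. *)

Lemma trilinearN (K : fieldType) (A : vectType K) (f : A -> A -> A -> A) :
  trilinear f ->
  [/\ forall x y z, f (- x) y z = - f x y z,
      forall x y z, f x (- y) z = - f x y z
    & forall x y z, f x y (- z) = - f x y z].
Proof.
have linN (g : A -> A) : linear g -> forall x, g (- x) = - g x.
  (* The linearity equation at scalar [-1] and two zero vectors reads [g 0 = - g 0 + g 0]. *)
  move=> lg x; have g0 : g 0 = 0.
    by have := lg (-1) 0 0; rewrite scaler0 addr0 scaleN1r addNr.
  by have := lg (-1) x 0; rewrite g0 !addr0 !scaleN1r.
case=> l1 l2 l3; split=> x y z.
- exact: (linN (fun t => f t y z)).
- exact: (linN (fun t => f x t z)).
- exact: (linN (f x y)).
Qed.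

(* J (f (J x) (J y) z) = - f x y (J z), and likewise for the other two
   positions, so all the terms except - f (J x) (J y) (J z) cancel. *)
Lemma perfect_integrable_for (K : fieldType) (A : vectType K)
    (f : A -> A -> A -> A) (J : 'End(A)) :
  trilinear f -> almost_complex_structure J ->
  (forall x y z, J (f x y z) = - f (J x) (J y) (J z)) -> integrable_for f J.
Proof.
move=> /trilinearN[N1 N2 N3] JJ Jf x y z.
rewrite !Jf !JJ !(N1, N2, N3) !opprK.
by rewrite addrK -!addrA [f x (J y) z + _]addrC subrK subrr addr0.
Qed.

Theorem lemma4p18 (R : realType) (A : vectType R) (nw ne : A -> A -> A -> A)
    (alpha : 'End(A)) (hA : hom_L_dendriform3 nw ne alpha)
    (J : 'End(A)) (hJ : almost_complex_structure J)
    (hJalpha : forall x : A, J (alpha x) = alpha (J x))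
    (hnw : forall x y z : A, J (nw x y z) = - nw (J x) (J y) (J z))
    (hne : forall x y z : A, J (ne x y z) = - ne (J x) (J y) (J z)) :
  complex_structure nw ne alpha J.
Proof.
apply/complex_structureP; split=> //; apply: perfect_integrable_for => //.
- exact: nw_trilinear hA.
- exact: ne_trilinear hA.
Qed.
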